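(* There exists an absolute constant $C>0$ such that for every integer $n\geq 2$ there exists a set $A$ of non-negative integers with $|A|=n$ for which the cosine polynomial \[ f_A(x) = \sum_{a\in A}\cos(ax) \] satisfies \[ Z(f_A)\leq C\,(n\log n)^{2/3}. \]
   Context: For a function $f:\mathbb{R}\to\mathbb{R}$, $Z(f)$ denotes the number of zeros of $f$ in the interval $[0,2\pi]$, i.e. $Z(f)=|\{x\in[0,2\pi]: f(x)=0\}|$. *)

(* Defs.v *)
From HB Require Import structures.
From mathcomp Require Import all_boot all_order all_algebra.
From mathcomp Require Import finmap.
From mathcomp Require Import all_classical all_reals all_analysis.

Set Implicit Arguments.
Unset Strict Implicit.
Unset Printing Implicit Defensive.

Import Order.TTheory GRing.Theory Num.Theory.

Local Open Scope fset_scope.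
Local Open Scope classical_set_scope.
Local Open Scope ring_scope.

(* The value lies in [\bar R]: [counting] is [+oo] on an infinite zero set, so
   an upper bound by a real number includes the finiteness of the zero set. *)
Definition Z (R : realType) (f : R -> R) : \bar R :=
  counting [set x : R | 0 <= x <= 2 * pi /\ f x = 0].

Definition cos_poly (R : realType) (A : {fset nat}) (x : R) : R :=
  \sum_(a <- A) cos (a%:R * x).

(* Main.v *)
Require Import Defs.
From HB Require Import structures.
From mathcomp Require Import all_boot all_order all_algebra.
From mathcomp Require Import finmap.
From mathcomp Require Import all_classical all_reals all_analysis.
From mathcomp Require Import ring lra zify.

Set Implicit Arguments.
Unset Strict Implicit.
Unset Printing Implicit Defensive.

Import Order.TTheory GRing.Theory Num.Theory.
Import numFieldNormedType.Exports.

Local Open Scope fset_scope.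
Local Open Scope classical_set_scope.
Local Open Scope ring_scope.

(** The construction removes a well-chosen subset T of [0, K] from an interval
    of frequencies [0, N], where K is of order (n log n)^(2/3), N = n + |T| - 1
    is comparable to n, and A = [0, N] \ T has exactly n elements. By the
    Dirichlet kernel formula,

      2 sin(x/2) f_A(x) = sin((N + 1/2) x) - G(x),
      G(x) = 2 sin(x/2) (sum_{j in T} cos(j x) - 1/2),

    so that the zeros of f_A are the points where a fast sine wave meets the
    slowly varying function G. A zero can only occur where |G| <= 1.

    Cut [0, pi] into M = 16 n cells of length pi/M.

    - A cell holds at most five zeros. On so short a cell either the fourth or
      the fifth derivative of the fast wave stays of order N^4 or N^5, while
      the corresponding derivative of G is at most of order K^5 or K^6, hence
      negligible; Rolle's theorem concludes (card_at_most_fast_wave).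

    - A cell without point where |G| = 1 holds a zero only if |G| <= 1 at its
      left end. Since G^2 is a polynomial of degree at most 2K + 1 in cos x,
      all but 2K + 1 cells are decided by the value of G at their left end
      (card_at_most_slow_crossings, card_at_most_cells).

    - For a uniformly random T, the event |G(x)| <= 1 says that the random sum
      of the cos(j x) over j in T falls into an interval of length 1/sin(x/2).
      For every x at least m = K/4 of the numbers cos(j x) have absolute value
      at least 1/2, because cos(2 j x) = 2 cos(j x)^2 - 1, so the
      Littlewood-Offord inequality bounds the probability of this event by
      O((1 + 1/x) / sqrt m). Summing over the left ends x = pi i/M, some T has
      only O(M log M / sqrt m) of them with |G| <= 1
      (littlewood_offord_closed, exists_few_small_samples).

    The number of zeros is therefore O(K + n log n / sqrt K), and both terms
    are of order (n log n)^(2/3) for the chosen K. The comparison of K^5 with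
    N^4 needs n to be large; for the finitely many other n the cosine
    polynomial of [0, n - 1] has at most 2n zeros. *)

(** * Antichains and the Littlewood-Offord inequality *)

Lemma bin_le_mid (h k : nat) : ('C(h.*2, k) <= 'C(h.*2, h))%N.
Proof.
have up d : (d <= h -> 'C(h.*2, h - d) <= 'C(h.*2, h))%N.
  elim: d => [|d IHd] lt_dh; first by rewrite subn0.
  apply: leq_trans (IHd (ltnW lt_dh)).
  have -> : (h - d = (h - d.+1).+1)%N by lia.
  have := mul_bin_left h.*2 (h - d.+1).
  set a := 'C(_, _.+1); set b := 'C(_, _) => eq_ab.
  have pos : (0 < (h - d.+1).+1)%N by [].
  rewrite -(leq_pmul2l pos) eq_ab leq_mul2r; apply/orP; right; lia.
case: (leqP k h) => [le_kh | lt_hk]; first by rewrite -(subKn le_kh) up ?leq_subr.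
case: (leqP k h.*2) => [le_k2h | lt_2hk]; last by rewrite bin_small.
have -> : 'C(h.*2, k) = 'C(h.*2, h - (k - h)).
  by rewrite -[LHS]bin_sub //; congr 'C(_, _); lia.
by apply: up; lia.
Qed.

(** Passing from h to h + 1 multiplies 'C(2h, h) by 2 (2h + 1) / (h + 1), and
    (2h + 1) (2h + 3) <= 4 (h + 1)^2. *)
Lemma central_bin_sq_le (h : nat) : (h.*2.+1 * 'C(h.*2, h) ^ 2 <= 16 ^ h)%N.
Proof.
elim: h => [|h IHh] //.
have rec : (h.+1 * 'C(h.+1.*2, h.+1) = 2 * (h.*2.+1 * 'C(h.*2, h)))%N.
  have e1 := mul_bin_diag h.*2.+2 h.
  have e2 := mul_bin_down h.*2.+1 h.
  rewrite /= in e1 e2; rewrite doubleS.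
  have -> : (h.+1 * 'C(h.*2.+2, h.+1) = h.*2.+2 * 'C(h.*2.+1, h))%N by [].
  have e3 : (h.*2.+1 - h = h.+1)%N by lia.
  by rewrite e3 in e2; rewrite e2; lia.
have pos : (0 < h.+1 ^ 2)%N by rewrite expn_gt0.
rewrite -(leq_pmul2l pos).
set c := 'C(h.*2, h) in IHh rec; set c' := 'C(_, _) in rec *.
have -> : (h.+1 ^ 2 * (h.+1.*2.+1 * c' ^ 2) = h.+1.*2.+1 * (h.+1 * c') ^ 2)%N.
  by rewrite expnMn; lia.
rewrite rec (expnS 16).
set X := (16 ^ h)%N in IHh *; set w := h.*2.+1 in IHh *.
have -> : (h.+1.*2.+1 * (2 * (w * c)) ^ 2 = h.+1.*2.+1 * (4 * w) * (w * c ^ 2))%N.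
  by rewrite -!mulnn; ring.
apply: (@leq_trans (h.+1.*2.+1 * (4 * w) * X)); first by rewrite leq_mul2l IHh orbT.
rewrite [leqRHS]mulnA leq_mul2r; apply/orP; right; rewrite -mulnn /w; lia.
Qed.

(** Every binomial coefficient 'C(n, k) is at most 2^n / sqrt n, written without
    roots. The odd case reduces to the even one by Pascal's rule. *)
Lemma bin_sq_le (n k : nat) : (n * 'C(n, k) ^ 2 <= 4 ^ n)%N.
Proof.
have pow16 h : (16 ^ h = 4 ^ h.*2)%N by rewrite -muln2 mulnC expnM.
rewrite -(odd_double_half n); set h := n./2; case: (odd n).
  rewrite add1n (expnS 4) -pow16.
  have le_2c : ('C(h.*2.+1, k) <= 2 * 'C(h.*2, h))%N.
    case: k => [|k]; first by rewrite bin0 muln_gt0 bin_gt0; lia.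
    by rewrite binS mul2n -[leqRHS]addnn leq_add ?bin_le_mid.
  have := central_bin_sq_le h; set c := 'C(h.*2, h) in le_2c *.
  move=> le16; apply: (@leq_trans (4 * (h.*2.+1 * c ^ 2))); last by rewrite leq_mul2l.
  rewrite mulnCA leq_mul2l /=; apply: leq_trans (leq_mul le_2c le_2c) _.
  by rewrite -!mulnn; lia.
rewrite add0n -pow16; apply: leq_trans (central_bin_sq_le h).
by apply: leq_mul => //; rewrite leq_exp2r // bin_le_mid.
Qed.

Definition antichain (T : finType) (F : {set {set T}}) : Prop :=
  {in F &, forall A B : {set T}, A \subset B -> A = B}.

(** The Lubell-Yamamoto-Meshalkin inequality, by induction on the ground set.
    Unless F = {D}, no member of F is D, and 1 / 'C(|D|, |A|) is the average
    over i in D of 1 / 'C(|D| - 1, |A|) if i is not in A and 0 otherwise; for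
    each i the members avoiding i form an antichain of subsets of D :\ i. *)
Lemma lym (R : realFieldType) (T : finType) (D : {set T}) (F : {set {set T}}) :
    {in F, forall A : {set T}, A \subset D} -> antichain F ->
  \sum_(A in F) ('C(#|D|, #|A|)%:R : R)^-1 <= 1.
Proof.
elim: {D}_.+1 {-2}D (ltnSn #|D|) F => // n IHn D lt_D F subD antiF.
case: (boolP (D \in F)) => [DF | DnF].
  rewrite (big_pred1 D); first by rewrite binn invr1.
  move=> A; apply/idP/eqP => [AF | -> //]; exact: antiF (subD _ AF).
have ltD A : A \in F -> (#|A| < #|D|)%N.
  move=> AF; rewrite ltn_neqAle subset_leq_card ?subD // andbT.
  apply: contra DnF => /eqP eqAD; suff <- : A = D by [].
  by apply/eqP; rewrite eqEcard subD //= eqAD.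
have [D0 | Dpos] := posnP #|D|.
  by rewrite big1 // => A AF; move: (ltD _ AF); rewrite D0.
have Dr : 0 < #|D|%:R :> R by rewrite ltr0n.
(* Averaging over the removed element, then exchanging the two sums. *)
have -> : \sum_(A in F) ('C(#|D|, #|A|)%:R : R)^-1 =
    #|D|%:R^-1 * \sum_(i in D) \sum_(A in F | i \notin A) ('C(#|D|.-1, #|A|)%:R)^-1.
  rewrite [X in _ = _ * X](exchange_big_dep (fun A => A \in F)) /=; last by move=> i A _ /andP[].
  rewrite mulr_sumr; apply: eq_bigr => A AF.
  rewrite (eq_bigl (fun i => i \in D :\: A)); last first.
    by move=> i; rewrite !inE AF /= andbC.
  rewrite sumr_const cardsD (finset.setIidPr (subD _ AF)).
  have ltA := ltD _ AF.
  have e := mul_bin_down #|D| #|A|.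
  have p1 : 'C(#|D|, #|A|)%:R != 0 :> R by rewrite pnatr_eq0 -lt0n bin_gt0 ltnW.
  have p2 : 'C(#|D|.-1, #|A|)%:R != 0 :> R.
    by rewrite pnatr_eq0 -lt0n bin_gt0 -ltnS prednK.
  have eR : #|D|%:R * 'C(#|D|.-1, #|A|)%:R = (#|D| - #|A|)%:R * 'C(#|D|, #|A|)%:R :> R.
    by rewrite -!natrM e.
  rewrite -[X in _ = _ * X]mulr_natr.
  have -> : (#|D| - #|A|)%:R = #|D|%:R * 'C(#|D|.-1, #|A|)%:R / 'C(#|D|, #|A|)%:R :> R.
    by rewrite eR mulfK.
  by field; rewrite p1 p2 lt0r_neq0.
rewrite ler_pdivrMl // mulr1 -sum1_card natr_sum; apply: ler_sum => i iD.
have cardDi : #|D :\ i| = #|D|.-1 by rewrite [in RHS](cardsD1 i) iD.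
rewrite sum1_card -cardDi (eq_bigl (fun A => A \in [set A in F | i \notin A])); last by move=> A; rewrite inE.
apply: IHn; first by rewrite cardDi; move: lt_D Dpos; lia.
  move=> A; rewrite inE => /andP[AF iA].
  by rewrite subsetD1 subD.
by move=> A B; rewrite !inE => /andP[AF _] /andP[BF _]; apply: antiF.
Qed.

(** Sperner's theorem up to a constant: by [bin_sq_le] each term of the LYM sum is
    at least sqrt |D| / 2^|D|. *)
Lemma antichain_card_le (R : rcfType) (T : finType) (D : {set T}) (F : {set {set T}}) :
    (0 < #|D|)%N -> {in F, forall A : {set T}, A \subset D} -> antichain F ->
  #|F|%:R <= 2 ^+ #|D| / Num.sqrt (#|D|%:R : R).
Proof.
move=> Dpos subD /(lym R subD) lymF.
have sD : 0 < Num.sqrt (#|D|%:R : R) by rewrite sqrtr_gt0 ltr0n.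
rewrite ler_pdivlMr // -[leRHS]mulr1 -ler_pdivrMl ?exprn_gt0 //.
apply: le_trans lymF; rewrite -[#|F|]sum1_card natr_sum mulr_suml mulr_sumr.
apply: ler_sum => A AF.
have p1 : 0 < 'C(#|D|, #|A|)%:R :> R by rewrite ltr0n bin_gt0 subset_leq_card ?subD.
rewrite mul1r ler_pdivrMl ?exprn_gt0 // ler_pdivlMr // mulrC.
rewrite -(@ler_pXn2r _ 2) ?nnegrE ?mulr_ge0 ?exprn_ge0 ?ler0n ?sqrtr_ge0 //.
have four : 2 ^+ 2 = 4%:R :> R by rewrite -natrX.
rewrite exprMn sqr_sqrtr ?ler0n // -exprM mulnC exprM four.
by rewrite -!natrX -natrM ler_nat mulnC bin_sq_le.
Qed.

(** Erdos's argument. Fix the part of S outside D, and record S inside D after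
    flipping the indices with a negative coefficient, so that enlarging the
    record increases the sum by at least r per new index. Two different sums in
    an interval of length r then have incomparable records, which therefore
    form an antichain. *)
Lemma littlewood_offord (R : rcfType) (T : finType) (c : T -> R) (D : {set T}) (r t : R) :
    (0 < #|D|)%N -> {in D, forall i, r <= `|c i|} ->
  #|[set S : {set T} | t <= \sum_(i in S) c i < t + r]%SET|%:R
    <= 2 ^+ #|T| / Num.sqrt (#|D|%:R : R).
Proof.
move=> Dpos ler; set F := [set S | _]%SET.
have -> : #|F| = (\sum_(U in powerset (~: D)) #|[set S in F | S :\: D == U]|)%N.
  rewrite -sum1_card (partition_big (fun S => S :\: D) (mem (powerset (~: D)))) /=.
    by apply: eq_bigr => U _; rewrite -sum1_card; apply: eq_bigl => S; rewrite !inE.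
  by move=> S _; rewrite inE finset.subsetDr.
have -> : 2 ^+ #|T| / Num.sqrt #|D|%:R =
    \sum_(U in powerset (~: D)) (2 ^+ #|D| / Num.sqrt #|D|%:R) :> R.
  rewrite sumr_const card_powerset -[RHS]mulr_natl mulrA natrX -exprD addnC.
  by rewrite -cardsT -(finset.setIT D) -(cardsID D [set: T]) finset.setTI finset.setTD finset.setIT.
rewrite natr_sum; apply: ler_sum => U _.
(* The indices with a negative coefficient are flipped. *)
pose phi (S : {set T}) := [set i in D | (i \in S) (+) (c i < 0)].
set FU := [set S in F | _].
have phi_inj : {in FU &, injective phi}.
  move=> S S'; rewrite !inE => /andP[_ /eqP eU] /andP[_ /eqP eU'] /setP eqphi.
  apply/setP => i; case: (boolP (i \in D)) => iD.
    by move: (eqphi i); rewrite !inE iD /= => /addIb.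
  by move/setP: eU => /(_ i); move/setP: eU' => /(_ i); rewrite !inE iD /= => -> ->.
rewrite -(card_in_imset phi_inj); apply: antichain_card_le => //.
  by move=> A /imsetP[S _ ->]; apply/fintype.subsetP => i; rewrite inE => /andP[].
move=> _ _ /imsetP[S SF ->] /imsetP[S' SF' ->] /fintype.subsetP sub.
apply/eqP; apply/negPn/negP => neq.
have [i] : exists i, (i \in phi S') && (i \notin phi S).
  apply/existsP; apply: contraNT neq; rewrite negb_exists => /forallP none.
  rewrite finset.eqEsubset; apply/andP; split; apply/fintype.subsetP => i; first exact: sub.
  by move=> iS'; move: (none i); rewrite iS' /= negbK.
case/andP => iS' iS.
move: SF SF'; rewrite !finset.in_set => /andP[/andP[t1 t2] /eqP eU] /andP[/andP[t3 t4] /eqP eU'].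
pose e (X : {set T}) j := if j \in X then c j else 0.
have key j : e S j <= e S' j.
  rewrite /e; case: (boolP (j \in D)) => jD; last first.
    suff -> : (j \in S) = (j \in S') by [].
    by move/setP: eU => /(_ j); move/setP: eU' => /(_ j); rewrite !inE jD /= => -> ->.
  by have := sub j; rewrite !inE jD /=; case: (j \in S); case: (j \in S'); case: ltP => //= h1 h2;
    rewrite ?(ltW h1) //; have := h2 isT.
have keyi : e S i + r <= e S' i.
  move: iS iS'; rewrite !inE /e => + /andP[iD]; rewrite iD /=.
  have := ler _ iD.
  by case: (i \in S); case: (i \in S'); case: ltP => //= h1;
    rewrite ?(ltr0_norm h1) ?(ger0_norm h1) => h2 _ _; lra.
have : \sum_(j in S) c j + r <= \sum_(j in S') c j.
  rewrite (big_mkcond (mem S)) (big_mkcond (mem S')) /=.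
  rewrite (bigD1 i) //= [leRHS](bigD1 i) //= addrAC lerD //.
  by apply: ler_sum => j _; apply: key.
lra.
Qed.

(** A closed interval of length 2L is covered by at most 2L/r + 1 half-open
    intervals of length r. *)
Lemma littlewood_offord_closed (R : realType) (T : finType) (c : T -> R)
    (D : {set T}) (r t L : R) :
    0 < r -> 0 <= L -> (0 < #|D|)%N -> {in D, forall i, r <= `|c i|} ->
  #|[set S : {set T} | `|\sum_(i in S) c i - t| <= L]%SET|%:R
    <= (2 * L / r + 1) * (2 ^+ #|T| / Num.sqrt (#|D|%:R : R)).
Proof.
move=> r0 L0 D0 cD; set F := [set S | _]%SET.
(* The position of the sum from the left end t - L, in units of r. *)
pose pos (S : {set T}) := (\sum_(i in S) c i - (t - L)) / r.
pose q := Num.truncn (2 * L / r).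
have posF S : S \in F -> 0 <= pos S <= 2 * L / r.
  rewrite finset.in_set ler_norml => /andP[S1 S2].
  apply/andP; split; first by apply: divr_ge0; [lra | exact: ltW].
  by rewrite ler_pM2r ?invr_gt0 //; lra.
have qL : q%:R <= 2 * L / r by rewrite truncn_le !mulr_ge0 // invr_ge0 ltW.
have -> : #|F| = (\sum_(k < q.+1) #|[set S in F | (inord (Num.truncn (pos S)) : 'I_q.+1) == k]|)%N.
  rewrite -sum1_card (partition_big (fun S => inord (Num.truncn (pos S)) : 'I_q.+1) predT) //=.
  by apply: eq_bigr => k _; rewrite -sum1_card; apply: eq_bigl => S; rewrite !inE.
set B := 2 ^+ _ / _.
have B0 : 0 <= B by rewrite divr_ge0 ?exprn_ge0 ?sqrtr_ge0.
apply: (@le_trans _ _ (\sum_(k < q.+1) B)).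
  rewrite natr_sum; apply: ler_sum => k _.
  apply: le_trans (littlewood_offord (t - L + k%:R * r) D0 cD).
  rewrite ler_nat; apply: subset_leq_card; apply/fintype.subsetP => S.
  rewrite finset.in_set => /andP[SF /eqP idx].
  have /andP[p0 pL] := posF S SF.
  have /andP : (Num.truncn (pos S))%:R <= pos S < (Num.truncn (pos S)).+1%:R by apply: truncn_itv.
  have -> : Num.truncn (pos S) = k.
    by rewrite -idx inordK // ltnS le_truncn.
  rewrite ler_pdivlMr // ltr_pdivrMr // -natr1 mulrDl mul1r => -[k1 k2].
  by rewrite finset.in_set; apply/andP; split; lra.
rewrite sumr_const card_ord -[leLHS]mulr_natl ler_wpM2r // -natr1 lerD2r //.
Qed.

(** * Counting zeros *)

(** An upper bound for the number of elements; a bound on duplicate-free lists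
    includes finiteness. *)
Definition card_at_most (T : choiceType) (A : set T) (d : nat) : Prop :=
  forall s : seq T, uniq s -> {in s, forall x, A x} -> (size s <= d)%N.

Lemma counting_le (R : realType) (T : choiceType) (A : set T) (d : nat) :
  card_at_most A d -> ((counting A : \bar R) <= d%:R%:E)%E.
Proof.
move=> cardA; rewrite /counting; case: asboolP => [finA | infA].
  rewrite lee_fin ler_nat; apply: (cardA (enum_fset (fset_set A))); first exact: fset_uniq.
  by move=> x; rewrite in_fset_set // inE.
have [B BA ltB] := infinite_set_fset d.+1 infA.
have : (#|` B| <= d)%N by apply: (cardA (enum_fset B)); [exact: fset_uniq | move=> x xB; apply: BA].
by rewrite leqNgt ltB.
Qed.

Lemma card_at_most_fibers (T : choiceType) (I : finType) (A : set T) (f : T -> I)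
    (B : {set I}) (d : nat) :
    (forall x, A x -> f x \in B) ->
    (forall i, i \in B -> card_at_most [set x | A x /\ f x = i] d) ->
  card_at_most A (d * #|B|).
Proof.
move=> fB fib s uniq_s sA.
have -> : size s = (\sum_(i in B) \sum_(x <- s | f x == i) 1)%N.
  rewrite (exchange_big_dep predT) //= -sum1_size big_seq [RHS]big_seq.
  apply: eq_bigr => x xs.
  rewrite (big_pred1 (f x)) // => i /=.
  rewrite eq_sym andbC; case: eqP => //= ->; exact/fB/sA.
rewrite mulnC -sum_nat_const; apply: leq_sum => i iB.
rewrite sum1_count -size_filter; apply: (fib i iB); first exact: filter_uniq.
by move=> x; rewrite mem_filter => /andP[/eqP <- /sA].
Qed.

Lemma card_at_most_leq (T : choiceType) (A : set T) (d e : nat) :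
  (d <= e)%N -> card_at_most A d -> card_at_most A e.
Proof. by move=> de cardA s uniq_s /(cardA s uniq_s) le; apply: leq_trans de. Qed.

Lemma card_at_most_sub (T : choiceType) (A B : set T) (d : nat) :
  (forall x, A x -> B x) -> card_at_most B d -> card_at_most A d.
Proof. by move=> AB cardB s uniq_s sA; apply: cardB => // x /sA; apply: AB. Qed.

Lemma card_at_most_inj (T U : choiceType) (A : set T) (B : set U) (f : T -> U) (d : nat) :
    (forall x y, A x -> A y -> f x = f y -> x = y) -> (forall x, A x -> B (f x)) ->
  card_at_most B d -> card_at_most A d.
Proof.
move=> f_inj fB cardB s uniq_s sA; rewrite -(size_map f); apply: cardB.
  by rewrite map_inj_in_uniq // => x y /sA Ax /sA Ay; apply: f_inj.
by move=> _ /mapP[x /sA Ax ->]; apply: fB.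
Qed.

Lemma card_at_mostU (T : choiceType) (A B : set T) (d e : nat) :
  card_at_most A d -> card_at_most B e -> card_at_most (A `|` B) (d + e).
Proof.
move=> cardA cardB s uniq_s sAB.
rewrite -(count_predC (fun x => `[< A x >]) s) -!size_filter leq_add //.
  apply: cardA; first exact: filter_uniq.
  by move=> x; rewrite mem_filter => /andP[/asboolP].
apply: cardB; first exact: filter_uniq.
by move=> x; rewrite mem_filter /= => /andP[/asboolPn nA /sAB[]].
Qed.

Lemma card_at_most1 (T : choiceType) (a : T) : card_at_most [set a] 1.
Proof.
move=> [|x [|y s]] //= /andP[xs _] sa; move: xs.
have -> : x = a by apply: sa; rewrite inE eqxx.
have -> : y = a by apply: sa; rewrite !inE eqxx orbT.
by rewrite inE eqxx.
Qed.

Lemma card_at_most_Rolle (R : realType) (f f' : R -> R) (a b : R) (d : nat) :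
    (forall x : R, is_derive x (1 : R) f (f' x)) ->
    card_at_most [set x | a <= x < b /\ f' x = 0] d ->
  card_at_most [set x | a <= x < b /\ f x = 0] d.+1.
Proof.
move=> f_der cardf' s uniq_s s_zero.
have zeros x s0 : path <%R x s0 -> {in x :: s0, forall y, a <= y < b /\ f y = 0} ->
    exists s', [/\ path <%R x s', size s' = size s0 &
                   {in s', forall y, a <= y < b /\ f' y = 0}].
  elim: s0 x => [|y s0 IHs] x /=; first by move=> _ _; exists [::].
  case/andP=> lt_xy path_y zero; have [|s' [path_s' size_s' zero_s']] := IHs _ path_y.
    by move=> z zs; apply: zero; rewrite inE zs orbT.
  have [/andP[ax xb] fx0] := zero x (mem_head _ _).
  have [|/andP[ay yb] fy0] := zero y; first by rewrite !inE eqxx orbT.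
  have [||c] := Rolle lt_xy _ _ (etrans fx0 (esym fy0)).
  - by move=> z _; apply: ex_derive.
  - apply: derivable_within_continuous => z _; exact: ex_derive.
  rewrite in_itv /= => /andP[xc cy] derc.
  have f'c : f' c = 0 by have [_ <-] := f_der c; have [_ ->] := derc.
  exists (c :: s'); split => /=.
  - by rewrite xc; apply: path_le path_s' => //; apply: lt_trans.
  - by rewrite size_s'.
  - move=> z; rewrite inE => /predU1P[->|/zero_s' //].
    by rewrite f'c; split => //; apply/andP; split; lra.
have sorted_s : sorted <%R (sort <=%R s) by rewrite sort_lt_sorted.
have mem_s z : (z \in sort <=%R s) = (z \in s) by rewrite mem_sort.
rewrite -(size_sort <=%R s).
case: (sort _ s) sorted_s mem_s => [|x s0] //= path_s mem_s.
have [|s' [path_s' <- zero_s']] := zeros _ _ path_s.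
  by move=> z; rewrite mem_s => /s_zero.
rewrite ltnS; apply: cardf' => //.
by apply: (sorted_uniq lt_trans ltxx); apply: path_sorted path_s'.
Qed.

(** * Sums of waves and cosine polynomials *)

(** A triple (c, w, phi) stands for the wave c sin(w x + phi). The phase makes
    the sums of waves closed under differentiation. *)
Definition trig (R : realType) (l : seq (R * R * R)) (x : R) : R :=
  \sum_(p <- l) p.1.1 * sin (p.1.2 * x + p.2).

(** Each differentiation multiplies a wave by its frequency and advances its
    phase by pi / 2, which gives the [d]-th derivative in closed form. *)
Definition dtrig (R : realType) (d : nat) (l : seq (R * R * R)) : seq (R * R * R) :=
  [seq (p.1.1 * p.1.2 ^+ d, p.1.2, p.2 + d%:R * (pi / 2)) | p <- l].

Lemma is_derive_trig (R : realType) (l : seq (R * R * R)) (d : nat) (x : R) :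
  is_derive x 1 (trig (dtrig d l)) (trig (dtrig d.+1 l) x).
Proof.
elim: l => [|[[c w] ph] l IHl].
  have trig_nil e : trig (dtrig e [::]) = cst (0 : R).
    by apply/funext => y; rewrite /trig /= big_nil.
  by rewrite !trig_nil; apply: is_derive_cst.
have eqD e y : trig (dtrig e ((c, w, ph) :: l)) y =
    c * w ^+ e * sin (w * y + (ph + e%:R * (pi / 2))) + trig (dtrig e l) y.
  by rewrite /trig /= big_cons.
rewrite eqD (_ : trig (dtrig d _) = (fun y => c * w ^+ d * sin (w * y + (ph + d%:R * (pi / 2))))
  \+ trig (dtrig d l)); last by apply/funext => y; rewrite eqD.
apply: is_deriveD.
have -> : w * x + (ph + d.+1%:R * (pi / 2)) = w * x + (ph + d%:R * (pi / 2)) + pi / 2.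
  by rewrite -natr1; ring.
rewrite sinDpihalf exprS.
apply: is_derive_eq.
by rewrite /GRing.scale /=; ring.
Qed.

Lemma dtrig0 (R : realType) (l : seq (R * R * R)) : dtrig 0 l = l.
Proof.
rewrite /dtrig -[RHS]map_id; apply: eq_map => -[[c w] ph] /=.
by rewrite expr0 mulr1 mul0r addr0.
Qed.

(** Rolle's theorem applied [d] times. *)
Lemma card_at_most_trig (R : realType) (l : seq (R * R * R)) (a b : R) (d : nat) :
    (forall x, a <= x < b -> trig (dtrig d l) x != 0) ->
  card_at_most [set x | a <= x < b /\ trig l x = 0] d.
Proof.
suff gen k j : (forall x, a <= x < b -> trig (dtrig (k + j) l) x != 0) ->
   card_at_most [set x | a <= x < b /\ trig (dtrig j l) x = 0] k.
  by move=> nz; have := gen d 0%N; rewrite addn0 dtrig0; apply.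
elim: k j => [|k IHk] j nz.
  move=> [|x s] //= _ zero.
  by have [/nz/eqP] := zero x (mem_head _ _).
apply: card_at_most_Rolle (is_derive_trig l j) _.
by apply: IHk => x /nz; rewrite addSnnS.
Qed.

Lemma trig_dtrig_le (R : realType) (l : seq (R * R * R)) (W : R) (d : nat) (x : R) :
    {in l, forall p, `|p.1.1| <= 1 /\ `|p.1.2| <= W} ->
  `|trig (dtrig d l) x| <= (size l)%:R * W ^+ d.
Proof.
elim: l => [|[[c w] ph] l IHl] le1.
  by rewrite /trig /= big_nil normr0 mul0r.
rewrite /trig /= big_cons.
have -> : (size l).+1%:R = 1 + (size l)%:R :> R by rewrite -natr1 addrC.
rewrite [leRHS]mulrDl mul1r.
apply: (le_trans (ler_normD _ _)); apply: lerD.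
  have [/= c1 wW] := le1 _ (mem_head _ _).
  rewrite !normrM normrX.
  have s1 : `|sin (w * x + (ph + d%:R * (pi / 2)))| <= 1.
    by rewrite ler_norml sin_geN1 sin_le1.
  have cw : `|c| * `|w| ^+ d <= W ^+ d.
    rewrite -[leRHS]mul1r; apply: ler_pM; rewrite ?exprn_ge0 // lerXn2r // nnegrE.
    by rewrite (le_trans _ wW).
  by rewrite -[leRHS]mulr1; apply: ler_pM => //; rewrite mulr_ge0 ?exprn_ge0.
by apply: IHl => p pl; apply: le1; rewrite inE pl orbT.
Qed.

Fixpoint chebyshev (R : nzRingType) (n : nat) : {poly R} :=
  match n with
  | 0 => 1
  | n'.+1 => match n' with
             | 0 => 'X
             | n''.+1 => 'X * chebyshev R n' *+ 2 - chebyshev R n''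
             end
  end.

Lemma size_chebyshev (R : nzRingType) (n : nat) : (size (chebyshev R n) <= n.+1)%N.
Proof.
suff : (size (chebyshev R n) <= n.+1)%N /\ (size (chebyshev R n.+1) <= n.+2)%N by case.
elim: n => [|n [IH1 IH2]]; first by rewrite /= size_poly1 size_polyX.
split => //; rewrite -[chebyshev R n.+2]/('X * chebyshev R n.+1 *+ 2 - chebyshev R n).
apply: leq_trans (size_polyD _ _) _; rewrite geq_max size_polyN.
apply/andP; split; last by apply: leq_trans IH1 _; rewrite ltnW.
rewrite -scaler_nat; apply: leq_trans (size_scale_leq _ _) _.
by apply: leq_trans (size_polyMleq _ _) _; rewrite size_polyX.
Qed.

Lemma horner_chebyshev (R : realType) (n : nat) (x : R) :
  (chebyshev R n).[cos x] = cos (n%:R * x).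
Proof.
suff : (chebyshev R n).[cos x] = cos (n%:R * x) /\
       (chebyshev R n.+1).[cos x] = cos (n.+1%:R * x) by case.
elim: n => [|n [IH1 IH2]]; first by rewrite /= hornerC hornerX mul0r cos0 mul1r.
split => //; rewrite -[chebyshev R n.+2]/('X * chebyshev R n.+1 *+ 2 - chebyshev R n).
rewrite hornerD hornerN hornerMn -commr_polyX hornerMX IH1 IH2.
have -> : n.+2%:R * x = n.+1%:R * x + x by rewrite -[n.+2]addn1 natrD; ring.
have -> : n%:R * x = n.+1%:R * x - x by rewrite -[n.+1]addn1 natrD; ring.
by rewrite cosB cosD; ring.
Qed.

(** The cosine is injective on [0, pi], so distinct zeros give distinct roots. *)
Lemma card_at_most_horner_cos (R : realType) (p : {poly R}) (d : nat) :
    p != 0 -> (size p <= d.+1)%N ->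
  card_at_most [set x | 0 <= x <= pi /\ p.[cos x] = 0] d.
Proof.
move=> p0 size_p s uniq_s zero.
rewrite -ltnS; apply: leq_trans size_p; rewrite -(size_map (@cos R)).
apply: max_poly_roots => //.
  by apply/allP => _ /mapP[x xs ->]; have [_ px0] := zero _ xs; apply/eqP.
rewrite map_inj_in_uniq // => x y xs ys; apply: cos_inj; rewrite in_itv /=.
  by have [] := zero _ xs.
by have [] := zero _ ys.
Qed.

Lemma sin_dist_le (R : realType) (x y : R) : `|sin x - sin y| <= `|x - y|.
Proof.
wlog lt_yx : x y / y < x => [hwlog|].
  case: (ltgtP x y) => [lt_xy | lt_yx | ->]; last by rewrite !subrr.
    by rewrite distrC [leRHS]distrC; apply: hwlog.
  exact: hwlog.
have [|c _ ->] := @MVT R (@sin R) (@cos R) y x lt_yx.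
  by apply: continuous_subspaceT => z; apply: continuous_sin.
by rewrite normrM ler_piMl // cos_max.
Qed.

Lemma cos_dist_le (R : realType) (x y : R) : `|cos x - cos y| <= `|x - y|.
Proof.
rewrite -!sinDpihalf; apply: le_trans (sin_dist_le _ _) _.
by rewrite opprD addrACA subrr addr0.
Qed.

(** From sin y = 2 sin(y/2) cos(y/2) and sin(y/2) = (y/2) cos c with c < y/2: both
    cosines are at least cos(pi/4), whose square is 1/2. *)
Lemma sin_ge_half (R : realType) (y : R) : 0 <= y <= pi / 2 -> y / 2 <= sin y.
Proof.
case/andP => y0 ypi; case: (ltgtP 0 y) y0 => // [y0 _ | <- _]; last by rewrite sin0 mul0r.
have pi0 := pi_gt0 R.
set q := cos (pi / 4) : R.
have q2 : q ^+ 2 = 1 / 2.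
  have : cos (pi / 4 + pi / 4) = 0 :> R by rewrite -(cos_pihalf R); congr cos; field.
  by rewrite cosD -!expr2 sin2cos2 -/q; lra.
have q0 : 0 <= q by apply: cos_ge0_pihalf; lra.
have cosq z : 0 <= z <= pi / 4 -> q <= cos z.
  case/andP => z0 z1; rewrite leNgt /q ltr_cos ?in_itv /=; lra.
have [||c] := @MVT R (@sin R) (@cos R) 0 (y / 2) _.
- by rewrite divr_gt0.
- by apply: continuous_subspaceT => z; apply: continuous_sin.
rewrite in_itv /= sin0 !subr0 => /andP[c0 cy] sin_y2.
have -> : sin y = 2 * sin (y / 2) * cos (y / 2).
  have {1}-> : y = y / 2 + y / 2 by field.
  by rewrite sinD; ring.
have le1 : q <= cos c by apply: cosq; lra.
have le2 : q <= cos (y / 2) by apply: cosq; lra.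
rewrite sin_y2; have : q * q <= cos c * cos (y / 2) by apply: ler_pM.
rewrite -expr2 q2 => le3.
have : y * (1 / 2) <= y * (cos c * cos (y / 2)) by rewrite ler_wpM2l // ltW.
lra.
Qed.

(** On an interval this short the argument w x moves by at most 1/2, so one of
    |sin(w x)|, |cos(w x)| is at least 1/5 throughout: at the left end one of
    them is at least 7/10. These are the moduli of the fourth and the fifth
    derivative of the wave up to the factors w^4 and w^5, and the corresponding
    derivative of the remaining waves is too small to cancel them. *)
Lemma card_at_most_fast_wave (R : realType) (l : seq (R * R * R)) (W w a b : R) :
    {in l, forall p, `|p.1.1| <= 1 /\ `|p.1.2| <= W} ->
    0 <= W -> W <= w -> 5 * ((size l)%:R * W ^+ 4) < w ^+ 4 ->
    (b - a) * w <= 1 / 2 ->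
  card_at_most [set x | a <= x < b /\ sin (w * x) + trig l x = 0] 5.
Proof.
move=> l_le W0 Ww dom short.
have w0 : 0 <= w by apply: le_trans Ww.
have near x (u v : R) : a <= x < b -> `|u - v| <= `|w * x - w * a| ->
    7 / 10 <= `|v| -> 1 / 5 <= `|u|.
  move=> /andP[ax xb] uv v7.
  have : `|v| <= `|u| + `|u - v|.
    by have := ler_normB u (u - v); rewrite subKr.
  have : `|w * x - w * a| <= 1 / 2.
    rewrite -mulrBr ger0_norm ?mulr_ge0 ?subr_ge0 // mulrC; apply: le_trans short.
    by rewrite ler_wpM2r // lerD2r ltW.
  lra.
have waveE d x : trig (dtrig d ((1, w, 0) :: l)) x =
    w ^+ d * sin (w * x + d%:R * (pi / 2)) + trig (dtrig d l) x.
  by rewrite /trig /= big_cons /= mul1r add0r.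
have nonzero d x : 5 * ((size l)%:R * W ^+ d) < w ^+ d ->
    1 / 5 <= `|sin (w * x + d%:R * (pi / 2))| -> trig (dtrig d ((1, w, 0) :: l)) x != 0.
  move=> domd s5; rewrite waveE addr_eq0; apply/eqP => eqN.
  have := trig_dtrig_le d x l_le; rewrite -normrN -eqN normrM ger0_norm ?exprn_ge0 //.
  have : w ^+ d * (1 / 5) <= w ^+ d * `|sin (w * x + d%:R * (pi / 2))|.
    by rewrite ler_wpM2l ?exprn_ge0.
  lra.
have zeroE x : sin (w * x) + trig l x = trig ((1, w, 0) :: l) x.
  by rewrite -[in RHS](dtrig0 (_ :: _)) waveE dtrig0 mul0r expr0 mul1r addr0.
have card_d d : (forall x, a <= x < b -> trig (dtrig d ((1, w, 0) :: l)) x != 0) ->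
    card_at_most [set x | a <= x < b /\ sin (w * x) + trig l x = 0] d.
  move=> /card_at_most_trig; apply: card_at_most_sub => x [? zx].
  by split => //; rewrite -zeroE.
have sin4 y : sin (y + 4%:R * (pi / 2)) = sin y :> R.
  have -> : 4%:R * (pi / 2) = pi *+ 2 :> R by rewrite -mulr_natl; field.
  exact: sinD2pi.
(* 7/10 is below 1 / sqrt 2, and the argument w x moves by at most 1/2. *)
case: (lerP (7 / 10) `|sin (w * a)|) => [s7 | /ltW s7].
  apply: (@card_at_most_leq _ _ 4) => //; apply: card_d => x xab.
  by apply: nonzero => //; rewrite sin4; apply: (near x _ (sin (w * a))) => //; apply: sin_dist_le.
apply: card_d => x xab; apply: nonzero.
  rewrite !exprSr mulrA mulrA -[5 * _ * _]mulrA.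
  have w_gt0 : 0 < w ^+ 4.
    by apply: le_lt_trans dom; rewrite !mulr_ge0 // exprn_ge0.
  have w_pos : 0 < w by rewrite lt_neqAle w0 andbT eq_sym; apply: contraTneq w_gt0 => ->;
    rewrite expr0n ltxx.
  have h1 : 0 <= 5 * ((size l)%:R * W ^+ 4) by rewrite !mulr_ge0 // exprn_ge0.
  rewrite -!exprSr.
  have : 5 * ((size l)%:R * W ^+ 4) * W <= 5 * ((size l)%:R * W ^+ 4) * w by rewrite ler_wpM2l.
  have : 5 * ((size l)%:R * W ^+ 4) * w < w ^+ 4 * w by rewrite ltr_pM2r.
  rewrite !exprSr; lra.
have -> : w * x + 5%:R * (pi / 2) = (w * x + pi / 2) + 4%:R * (pi / 2) by ring.
rewrite sin4 sinDpihalf; apply: (near x _ (cos (w * a))) => //; first exact: cos_dist_le.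
have := cos2sin2 (w * a); rewrite -(real_normK (num_real (cos _))) -(real_normK (num_real (sin _))).
have := normr_ge0 (sin (w * a)); have := normr_ge0 (cos (w * a)).
set S := `|sin _| in s7 *; set C := `|cos _| => C0 S0 SC.
rewrite leNgt; apply/negP => C7.
have : C ^+ 2 < (7 / 10) ^+ 2 by rewrite ltrXn2r.
have : S ^+ 2 <= (7 / 10) ^+ 2 by rewrite lerXn2r // nnegrE; lra.
lra.
Qed.

(** * Cells *)

(** The left end 0 of the first cell is left out: every [slow_part] vanishes there,
    so the first cell is always counted separately. *)
Definition small_samples (R : realType) (G : R -> R) (M : nat) : {set 'I_M} :=
  [set i : 'I_M | (0 < i)%N && (`|G (i%:R * (pi / M%:R))| <= 1)]%SET.

(** If G has modulus greater than 1 at the left end of a cell and never has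
    modulus 1 in it, then by the intermediate value theorem its modulus stays
    greater than 1 there, and F has no zero in that cell. Distinct cells are
    disjoint, so at most [e] of them contain a point with G^2 = 1. *)
Lemma card_at_most_cells (R : realType) (F G : R -> R) (M d e : nat) :
    (0 < M)%N -> continuous G ->
    (forall x : R, 0 < x < pi -> F x = 0 -> `|G x| <= 1) ->
    (forall i : nat, card_at_most
       [set x | i%:R * (pi / M%:R) <= x < i.+1%:R * (pi / M%:R) /\ F x = 0] d) ->
    card_at_most [set x | 0 <= x <= pi /\ G x ^+ 2 = 1] e ->
  card_at_most [set x | 0 <= x < pi /\ F x = 0]
    (d * (1 + #|small_samples G M| + e)).
Proof.
move=> M_gt0 contG dominated few_zeros few_crossings.
set h := pi / M%:R : R in few_zeros.
pose cell (i : nat) : set R := [set x | i%:R * h <= x < i.+1%:R * h].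
have MR : 0 < M%:R :> R by rewrite ltr0n.
have h_gt0 : 0 < h by rewrite divr_gt0 ?pi_gt0.
have cellE i x : cell i x = (i%:R <= x / h < i.+1%:R) :> Prop.
  by rewrite /cell /= ler_pdivlMr // ltr_pdivrMr.
pose o := Ordinal M_gt0.
pose idx (x : R) : 'I_M := insubd o (Num.truncn (x / h)).
have cell_idx x : 0 <= x < pi -> cell (idx x) x.
  case/andP=> x0 xpi; rewrite cellE val_insubd.
  have xh0 : 0 <= x / h by rewrite divr_ge0 // ltW.
  have -> : (Num.truncn (x / h) < M)%N.
    move: xpi.
    have <- : M%:R * h = pi by rewrite /h mulrC divfK ?lt0r_neq0.
    by rewrite truncn_lt_nat // ltr_pdivrMr.
  exact: truncn_itv.
have cell_inj (i j : 'I_M) x : cell i x -> cell j x -> i = j.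
  rewrite !cellE => ci cj; apply/val_inj => /=.
  by rewrite -(truncn_def ci) -(truncn_def cj).
pose crossing (i : 'I_M) y := [/\ cell i y, 0 <= y <= pi & G y ^+ 2 = 1].
pose crossed : {set 'I_M} := [set i : 'I_M | `[< exists y, crossing i y >]]%SET.
have card_crossed : (#|crossed| <= e)%N.
  have pick_y i : exists y, i \in crossed -> crossing i y.
    case: (boolP (i \in crossed)) => [|_]; last by exists 0.
    by rewrite inE => /asboolP[y cy]; exists y.
  have [y y_cross] := choice pick_y.
  rewrite cardE -(size_map y); apply: few_crossings.
    rewrite map_inj_in_uniq ?enum_uniq // => i j; rewrite !mem_enum.
    move=> /y_cross[ci _ _] /y_cross[cj _ _] eq_y; apply: (cell_inj _ _ (y i)) => //.
    by rewrite eq_y.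
  by move=> _ /mapP[i + ->]; rewrite mem_enum => /y_cross[_ ? ?].
apply: (@card_at_most_leq _ _ (d * #|[set o] :|: small_samples G M :|: crossed|)).
  rewrite leq_mul2l; apply/orP; right.
  apply: leq_trans (leq_card_setU _ _) _; rewrite leq_add //.
  by apply: leq_trans (leq_card_setU _ _) _; rewrite cards1.
apply: (@card_at_most_fibers _ _ _ idx).
  move=> x [x_in Fx]; have := cell_idx _ x_in; set i := idx x => ci.
  case: (boolP (i == o)) => [/eqP -> | i_neq_o]; first by rewrite !inE eqxx.
  have i_gt0 : (0 < i)%N by rewrite lt0n; apply: contra i_neq_o => /eqP i0; apply/eqP/val_inj.
  rewrite !inE (negbTE i_neq_o) i_gt0 /=.
  case: lerP => //= Gi; apply/asboolP.
  move: ci => /andP[ci1 ci2]; move: (x_in) => /andP[x0 xpi].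
  have ih_gt0 : 0 < i%:R * h by rewrite mulr_gt0 ?ltr0n.
  have Gx : `|G x| <= 1 by apply: dominated => //; rewrite xpi (lt_le_trans ih_gt0).
  have [||y] := @IVT R (fun y => G y ^+ 2) (i%:R * h) x 1 ci1.
  - apply: continuous_subspaceT => z; apply: (@continuous_comp _ _ _ G (fun t : R => t ^+ 2)).
      exact: contG.
    exact: exprn_continuous.
  - rewrite ge_min le_max -(real_normK (num_real (G x))) -(real_normK (num_real (G _))).
    by rewrite (exprn_ile1 _ (normr_ge0 _) Gx) orbT exprn_ege1 // ltW.
  rewrite in_itv /= => /andP[y1 y2] Gy; exists y; split => //.
    by apply/andP; split; last exact: le_lt_trans ci2.
  by rewrite (le_trans (ltW ih_gt0) y1) (le_trans y2 (ltW xpi)).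
move=> i _; apply: card_at_most_sub (few_zeros i) => x [[x_in Fx] idx_x].
by split => //; rewrite -idx_x; apply: cell_idx.
Qed.

(** * Intervals of frequencies with a small set removed *)

(** The function that a fast sine wave has to meet at a zero of the cosine
    polynomial of [0, N] \ s; see [cos_poly_gap_set]. *)
Definition slow_part (R : realType) (s : seq nat) (x : R) : R :=
  2 * sin (x / 2) * (\sum_(j <- s) cos (j%:R * x) - 1 / 2).

Definition gap_set (N : nat) (s : seq nat) : {fset nat} :=
  [fset j in [seq j <- iota 0 N.+1 | j \notin s]].

Lemma perm_gap_set (N : nat) (s : seq nat) :
  perm_eq (gap_set N s) [seq j <- iota 0 N.+1 | j \notin s].
Proof.
apply: uniq_perm; rewrite ?fset_uniq ?filter_uniq ?iota_uniq // => j.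
by rewrite !inE.
Qed.

Lemma perm_iota_gap (N K : nat) (s : seq nat) :
    (K <= N)%N -> uniq s -> all (fun j => j <= K)%N s ->
  perm_eq (iota 0 N.+1) (gap_set N s ++ s).
Proof.
move=> KN uniq_s /allP s_le.
rewrite -(perm_filterC (mem s)) perm_catC perm_cat //.
  by rewrite perm_sym perm_gap_set.
apply: uniq_perm; rewrite ?filter_uniq ?iota_uniq // => j.
rewrite mem_filter mem_iota /= add0n ltnS andbC.
by case: (boolP (j \in s)) => [/s_le jK|]; rewrite ?andbF // (leq_trans jK).
Qed.

Lemma card_gap_set (N K : nat) (s : seq nat) :
    (K <= N)%N -> uniq s -> all (fun j => j <= K)%N s ->
  (#|` gap_set N s| + size s = N.+1)%N.
Proof.
move=> KN uniq_s s_le; have /perm_size := perm_iota_gap KN uniq_s s_le.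
by rewrite size_iota size_cat => ->.
Qed.

Lemma dirichlet_kernel (R : realType) (N : nat) (x : R) :
  2 * sin (x / 2) * \sum_(j <- iota 0 N.+1) cos (j%:R * x) =
    sin ((N%:R + 1 / 2) * x) + sin (x / 2).
Proof.
elim: N => [|N IHN].
  rewrite big_seq1 mul0r cos0 add0r (_ : 1 / 2 * x = x / 2); last by field.
  by ring.
rewrite -[N.+2]addn1 iotaD big_cat mulrDr IHN big_seq1 add0n.
have -> : (N%:R + 1 / 2) * x = N.+1%:R * x - x / 2 by rewrite -natr1; field.
have -> : (N.+1%:R + 1 / 2) * x = N.+1%:R * x + x / 2 by field.
by rewrite sinB sinD; ring.
Qed.

Lemma cos_poly_gap_set (R : realType) (N K : nat) (s : seq nat) (x : R) :
    (K <= N)%N -> uniq s -> all (fun j => j <= K)%N s ->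
  2 * sin (x / 2) * cos_poly (gap_set N s) x =
    sin ((N%:R + 1 / 2) * x) - slow_part s x.
Proof.
move=> KN uniq_s s_le; have := dirichlet_kernel N x.
rewrite (perm_big _ (perm_iota_gap KN uniq_s s_le)) big_cat /= -/(cos_poly _ x).
move=> /esym/(canRL (addrK _)) ->.
by rewrite /slow_part; field.
Qed.

Lemma cos_poly_sym (R : realType) (A : {fset nat}) (x : R) :
  cos_poly A (2 * pi - x) = cos_poly A x.
Proof.
apply: eq_bigr => j _; rewrite -!horner_chebyshev; congr (_.[_]).
by rewrite cosB mulr_natl cos2pi sin2pi mul1r mul0r addr0.
Qed.

(** The waves of - slow_part s, from
    2 sin(x/2) cos(j x) = sin((j + 1/2) x) - sin((j - 1/2) x). *)
Definition slow_trig (R : realType) (s : seq nat) : seq (R * R * R) :=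
  (1, 1 / 2, 0) :: [seq (-1, j%:R + 1 / 2, 0) | j <- s] ++
                   [seq (1, j%:R - 1 / 2, 0) | j <- s].

Lemma trig_slow_part (R : realType) (s : seq nat) (x : R) :
  trig (slow_trig R s) x = - slow_part s x.
Proof.
rewrite /trig big_cons big_cat !big_map /= -big_split /= /slow_part.
rewrite mulrBr opprB mulr_sumr -sumrN; congr (_ + _).
  by rewrite addr0 (_ : 1 / 2 * x = x / 2); field.
apply: eq_bigr => j _; rewrite !addr0.
have -> : (j%:R + 1 / 2) * x = j%:R * x + x / 2 by field.
have -> : (j%:R - 1 / 2) * x = j%:R * x - x / 2 by field.
by rewrite sinB sinD; ring.
Qed.

(** As 4 sin(x/2)^2 = 2 (1 - cos x), the function G^2 - 1 is a polynomial of degree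
    at most 2K + 1 in cos x. It is not zero because its value at x = 0 is -1. *)
Lemma card_at_most_slow_crossings (R : realType) (K : nat) (s : seq nat) :
    all (fun j => j <= K)%N s ->
  card_at_most [set x : R | 0 <= x <= pi /\ slow_part s x ^+ 2 = 1] K.*2.+1.
Proof.
move=> /allP s_le.
pose q : {poly R} := \sum_(j <- s) chebyshev R j - (1 / 2)%:P.
pose p : {poly R} := 2 *: (1 - 'X) * q ^+ 2 - 1.
have pE x : p.[cos x] = slow_part s x ^+ 2 - 1.
  rewrite /p !(hornerD, hornerN, hornerM, hornerZ, horner_exp, hornerC, hornerX, horner_sum).
  rewrite /slow_part.
  rewrite (eq_bigr (fun j : nat => cos (j%:R * x))); last by move=> j _; rewrite horner_chebyshev.
  have -> : cos x = 1 - 2 * sin (x / 2) ^+ 2.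
    have {1}-> : x = x / 2 + x / 2 by field.
    by rewrite cosD -!expr2 cos2sin2; ring.
  by ring.
have p_neq0 : p != 0.
  apply/eqP => p0; have := pE 0; rewrite p0 horner0 /slow_part mul0r sin0 mulr0 mul0r.
  by rewrite expr0n /= sub0r => /eqP; rewrite eq_sym oppr_eq0 oner_eq0.
have size_q : (size q <= K.+1)%N.
  apply: leq_trans (size_polyD _ _) _; rewrite geq_max size_polyN.
  rewrite (leq_trans (size_polyC_leq1 _)) // andbT.
  rewrite big_seq; apply: leq_trans (size_sum _ _ _) _; apply/bigmax_leqP_seq => j js _.
  by apply: leq_trans (size_chebyshev _ _) _; rewrite ltnS s_le.
have size_p : (size p <= K.*2.+2)%N.
  apply: leq_trans (size_polyD _ _) _; rewrite geq_max size_polyN size_poly1 andbT.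
  apply: leq_trans (size_polyMleq _ _) _.
  have : (size (2 *: (1 - 'X) : {poly R}) <= 2)%N.
    apply: leq_trans (size_scale_leq _ _) _; rewrite -size_polyN opprB.
    by rewrite (size_XsubC 1).
  have := size_polyMleq q q; rewrite -expr2; lia.
apply: card_at_most_sub (card_at_most_horner_cos p_neq0 size_p) => x [? eq1].
by split => //; rewrite pE eq1 subrr.
Qed.

Lemma continuous_slow_part (R : realType) (s : seq nat) :
  continuous (@slow_part R s).
Proof.
move=> x.
have -> : slow_part s = \- trig (dtrig 0 (slow_trig R s)).
  by apply/funext => y; rewrite dtrig0 /= trig_slow_part opprK.
apply: continuousN; apply: differentiable_continuous; apply/derivable1_diffP.
by have [] := is_derive_trig (slow_trig R s) 0 x.
Qed.

(** The reflection x -> 2 pi - x preserves the zeros. *)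
Lemma card_at_most_cos_poly_2pi (R : realType) (A : {fset nat}) (d : nat) :
    card_at_most [set x : R | 0 <= x <= pi /\ cos_poly A x = 0] d ->
  card_at_most [set x : R | 0 <= x <= 2 * pi /\ cos_poly A x = 0] (2 * d).
Proof.
move=> card_pi; rewrite mul2n -addnn.
have card_2pi : card_at_most [set x : R | pi <= x <= 2 * pi /\ cos_poly A x = 0] d.
  apply: (card_at_most_inj (f := fun x : R => 2 * pi - x)) card_pi.
    by move=> x y _ _ /addrI/oppr_inj.
  by move=> x [/andP[x0 xpi] zx]; split; rewrite ?cos_poly_sym //; apply/andP; split; lra.
apply: card_at_most_sub (card_at_mostU card_pi card_2pi).
move=> x [/andP[x0 x2pi] zx]; case: (lerP x pi) => xpi; [left | right]; split => //.
  by rewrite x0.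
by rewrite ltW.
Qed.

(** A crude bound through the degree in cos x, used for small n. *)
Lemma card_at_most_cos_poly (R : realType) (A : {fset nat}) (N : nat) :
    (0 < #|` A|)%N -> {in A, forall j, (j <= N)%N} ->
  card_at_most [set x : R | 0 <= x <= 2 * pi /\ cos_poly A x = 0] (2 * N).
Proof.
move=> A_gt0 A_le; apply: card_at_most_cos_poly_2pi.
pose p : {poly R} := \sum_(j <- A) chebyshev R j.
have pE x : p.[cos x] = cos_poly A x.
  by rewrite horner_sum; apply: eq_bigr => j _; rewrite horner_chebyshev.
have p_neq0 : p != 0.
  apply/eqP => p0; have := pE 0; rewrite p0 horner0 /cos_poly.
  rewrite (eq_bigr (fun=> 1)); last by move=> j _; rewrite mulr0 cos0.
  by move/eqP; rewrite -(natr_sum R _ _ (fun=> 1%N)) sum1_size eq_sym pnatr_eq0 -leqn0 leqNgt A_gt0.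
have size_p : (size p <= N.+1)%N.
  rewrite /p big_seq; apply: leq_trans (size_sum _ _ _) _; apply/bigmax_leqP_seq => j jA _.
  by apply: leq_trans (size_chebyshev _ _) _; rewrite ltnS A_le.
apply: card_at_most_sub (card_at_most_horner_cos p_neq0 size_p) => x [? eq0].
by split => //; rewrite pE.
Qed.

(** The deterministic half of the argument: the zeros are controlled by the number
    of cells at whose left end the slow part is at most 1. The final + 1 stands
    for the point pi, which lies in none of the M cells. *)
Lemma card_at_most_gap_set (R : realType) (N K M : nat) (s : seq nat) :
    (K <= N)%N -> uniq s -> all (fun j => j <= K)%N s ->
    (size s <= K.+1)%N -> (0 < M)%N ->
    5 * (K.*2.+3%:R * K.+1%:R ^+ 4) < (N%:R + 1 / 2 : R) ^+ 4 ->
    K.+1%:R <= N%:R + 1 / 2 :> R ->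
    8 * (N%:R + 1 / 2) <= M%:R :> R ->
  card_at_most [set x : R | 0 <= x <= 2 * pi /\ cos_poly (gap_set N s) x = 0]
    (2 * (5 * (1 + #|small_samples (@slow_part R s) M| + K.*2.+1) + 1)).
Proof.
move=> KN uniq_s s_le size_s M_gt0 dom Kw wM.
set w : R := N%:R + 1 / 2 in dom Kw wM *; set G := slow_part s.
have pi_gt := pi_gt0 R; have pi_lt : pi < 4 :> R by have := pihalf_lt2 R; lra.
have MR : 0 < M%:R :> R by rewrite ltr0n.
have card_half : card_at_most [set x : R | 0 <= x < pi /\ sin (w * x) - G x = 0]
    (5 * (1 + #|small_samples G M| + K.*2.+1)).
  apply: card_at_most_cells => //.
  - exact: continuous_slow_part.
  - by move=> x _ /eqP; rewrite subr_eq0 => /eqP <-; apply: sin_max.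
  - move=> i.
    have in_l : {in slow_trig R s, forall p, `|p.1.1| <= 1 /\ `|p.1.2| <= K.+1%:R}.
      have le_half j : j \in s -> j%:R + 1 / 2 <= K.+1%:R :> R.
        move=> /(allP s_le) jK; have -> : K.+1%:R = K%:R + 1 :> R by rewrite natr1.
        by have : j%:R <= K%:R :> R; [rewrite ler_nat | lra].
      have j0 j : 0 <= j%:R :> R by [].
      have K1 : 1 <= K.+1%:R :> R by rewrite ler1n.
      move=> p; rewrite !inE mem_cat => /or3P[/eqP -> | /mapP[j js ->] | /mapP[j js ->]] /=;
        rewrite ?normrN normr1; split => //; rewrite ler_norml.
      + by apply/andP; split; lra.
      + by have := le_half _ js; have := j0 j; move=> *; apply/andP; split; lra.
      + by have := le_half _ js; have := j0 j; move=> *; apply/andP; split; lra.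
    have := @card_at_most_fast_wave R (slow_trig R s) K.+1%:R w
       (i%:R * (pi / M%:R)) (i.+1%:R * (pi / M%:R)) in_l (ler0n _ _) Kw.
    have -> : (i.+1%:R * (pi / M%:R) - i%:R * (pi / M%:R)) * w <= 1 / 2.
      have -> : i.+1%:R = i%:R + 1 :> R by rewrite natr1.
      have -> : ((i%:R + 1) * (pi / M%:R) - i%:R * (pi / M%:R)) * w = pi * w / M%:R by ring.
      rewrite ler_pdivrMr //.
      have : pi * w <= 4 * w by rewrite ler_wpM2r ?(ltW pi_lt) // (le_trans _ Kw).
      lra.
    have -> : 5 * ((size (slow_trig R s))%:R * K.+1%:R ^+ 4) < w ^+ 4.
      apply: le_lt_trans dom; rewrite ler_wpM2l // ler_wpM2r ?exprn_ge0 // ler_nat.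
      by rewrite /= size_cat !size_map; lia.
    move=> /(_ isT isT); apply: card_at_most_sub => x [? xz]; split => //.
    by rewrite trig_slow_part.
  - exact: card_at_most_slow_crossings.
have card_pi : card_at_most [set x : R | 0 <= x <= pi /\ cos_poly (gap_set N s) x = 0]
    (5 * (1 + #|small_samples G M| + K.*2.+1) + 1).
  apply: card_at_most_sub (card_at_mostU card_half (@card_at_most1 _ (pi : R))).
  move=> x [/andP[x0 xpi] zx]; case: (ltgtP x pi) xpi => // [lt_xpi _ | -> _]; last by right.
  left; split; first by rewrite x0.
  by rewrite -(cos_poly_gap_set _ KN uniq_s s_le) zx mulr0.
exact: card_at_most_cos_poly_2pi.
Qed.

(** * Choosing the removed set at random *)

(** For each j in (m, 2m] one of cos(j x), cos(2 j x) has modulus at least 1/2,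
    because cos(2 j x) = 2 cos(j x)^2 - 1. The pairs {j, 2j} are disjoint since
    2j > 2m. *)
Lemma many_large_cos (R : realType) (m : nat) (x : R) :
  (m <= #|[set j : 'I_(4 * m).+1 | (1 / 2 <= `|cos (j%:R * x)|)%R]%SET|)%N.
Proof.
pose large (j : nat) := 1 / 2 <= `|cos (j%:R * x)|.
pose f (i : 'I_m) : 'I_(4 * m).+1 :=
  let j := (m + i.+1)%N in inord (if large j then j else (2 * j)%N).
have f_val i : (f i : nat) = (if large (m + i.+1) then m + i.+1 else 2 * (m + i.+1))%N.
  by rewrite /f inordK //; case: ifP => _; have := ltn_ord i; lia.
have f_inj : injective f.
  move=> i j /(congr1 val) /=; rewrite !f_val => eq_f; apply: val_inj => /=.
  have := ltn_ord i; have := ltn_ord j.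
  by move: eq_f; do 2![case: ifP => _]; lia.
rewrite -[X in (X <= _)%N]card_ord -(card_codom f_inj).
apply: subset_leq_card; apply/fintype.subsetP => _ /codomP[i ->].
rewrite finset.in_set f_val; case: ifP => // /negbT.
rewrite /large -ltNge; set j := (m + i.+1)%N => small.
rewrite natrM -mulrA.
have -> : 2%:R * (j%:R * x) = j%:R * x + j%:R * x by ring.
rewrite cosD -!expr2 sin2cos2 -real_normK ?num_real //.
have : `|cos (j%:R * x)| ^+ 2 <= (1 / 2) ^+ 2 by rewrite lerXn2r ?nnegrE // ltW.
set C := `|cos _|; rewrite -normrN => C2.
by apply: le_trans (ler_norm _); lra.
Qed.

Lemma sum_inv_le_ln (R : realType) (M : nat) :
  \sum_(i < M.+2 | (0 < i)%N) (i%:R : R)^-1 <= 1 + ln M.+1%:R.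
Proof.
elim: M => [|M IHM].
  by rewrite big_mkcond !big_ord_recr big_ord0 /= !add0r invr1 ln1 addr0.
rewrite big_mkcond big_ord_recr -big_mkcond /=.
apply: (le_trans (lerD IHM (lexx _))); rewrite -addrA lerD2l.
have a0 : 0 < M.+1%:R :> R by rewrite ltr0n.
have b0 : 0 < M.+2%:R :> R by rewrite ltr0n.
have ab : M.+2%:R = M.+1%:R + 1 :> R by rewrite natr1.
have eq_ratio : M.+1%:R = M.+2%:R * (1 + - (M.+2%:R)^-1) :> R.
  by rewrite mulrDr mulrN divff ?lt0r_neq0 // ab mulr1 addrK.
have inv_lt : -1 < - (M.+2%:R : R)^-1 by rewrite ltrN2 invf_lt1 // ab ltrDr.
have ratio0 : 0 < 1 + - (M.+2%:R : R)^-1 by rewrite -ltrBlDl sub0r.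
rewrite {1}eq_ratio lnM ?posrE //.
rewrite -addrA gerDl -lerBrDr sub0r; exact: le_ln1Dx.
Qed.

(** First moment method over all subsets T. At x = pi i/M the condition |G| <= 1
    confines the sum of the cos(j x) to an interval of half-length
    L = 1 / (2 sin(x/2)) <= M/i, an event of probability at most
    (4L + 1) / sqrt m <= 5 (M/i) / sqrt m, and the sum of 1/i is at most
    1 + log M. *)
Lemma exists_few_small_samples (R : realType) (m M : nat) :
    (0 < m)%N -> (1 < M)%N ->
  exists T : {set 'I_(4 * m).+1},
    #|small_samples (@slow_part R [seq val j | j <- enum T]) M|%:R <=
      5 * M%:R * (1 + ln M%:R) / Num.sqrt (m%:R : R).
Proof.
move=> m_gt0 M_gt1; pose K := (4 * m)%N.
pose G (T : {set 'I_K.+1}) : R -> R := slow_part [seq val j | j <- enum T].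
have MR : 0 < M%:R :> R by rewrite ltr0n; lia.
have mR : 0 < Num.sqrt m%:R :> R by rewrite sqrtr_gt0 ltr0n.
have pi2 := pi_ge2 R; have pi0 := pi_gt0 R.
set P : R := 2 ^+ #|{: 'I_K.+1}|.
have P0 : 0 < P by rewrite exprn_gt0.
have rare (i : 'I_M) : (0 < i)%N ->
    #|[set T | `|G T (i%:R * (pi / M%:R))| <= 1]%SET|%:R <=
    5 * M%:R / i%:R * (P / Num.sqrt m%:R).
  move=> i0; set x := _ * (pi / _).
  have iR : 0 < i%:R :> R by rewrite ltr0n.
  have iM : i%:R <= M%:R :> R by rewrite ler_nat ltnW.
  have x0 : 0 < x by rewrite mulr_gt0 // divr_gt0.
  have xpi : x <= pi by rewrite /x mulrCA ger_pMr // ler_pdivrMr // mul1r.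
  have sin_ge : x / 4 <= sin (x / 2).
    have -> : x / 4 = x / 2 / 2 by field.
    by apply: sin_ge_half; apply/andP; split; lra.
  have x4 : 0 < x / 4 by rewrite divr_gt0.
  set L := (2 * sin (x / 2))^-1.
  have sin2 : 0 < 2 * sin (x / 2) by lra.
  have L0 : 0 <= L by rewrite invr_ge0 ltW.
  have L_le : L <= M%:R / i%:R.
    rewrite /L -[leRHS]invrK lef_pV2 ?posrE ?invr_gt0 ?divr_gt0 // invf_div.
    apply: le_trans (_ : x / 2 <= _); last by lra.
    have -> : x / 2 = i%:R / M%:R * (pi / 2) by rewrite /x; ring.
    by rewrite ler_peMr ?divr_ge0 //; lra.
  pose c (j : 'I_K.+1) := cos (j%:R * x).
  pose D := [set j : 'I_K.+1 | 1 / 2 <= `|c j|]%SET.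
  have mD : (m <= #|D|)%N := many_large_cos m x.
  have D0 : (0 < #|D|)%N by apply: leq_trans mD.
  have DR : 0 < Num.sqrt #|D|%:R :> R by rewrite sqrtr_gt0 ltr0n.
  have cD : {in D, forall j, 1 / 2 <= `|c j|} by move=> j; rewrite finset.in_set.
  have half0 : 0 < 1 / 2 :> R by lra.
  apply: (le_trans (_ : _ <= #|[set S : {set 'I_K.+1} | `|\sum_(j in S) c j - 1 / 2| <= L]%SET|%:R)).
    rewrite ler_nat; apply: subset_leq_card; apply/fintype.subsetP => T.
    rewrite !finset.in_set /G /slow_part big_map big_enum /= normrM gtr0_norm //.
    by rewrite -[L]mulr1 /L ler_pdivlMl.
  apply: le_trans (littlewood_offord_closed _ half0 L0 D0 cD) _.
  apply: ler_pM.
  - by rewrite addr_ge0 // divr_ge0 ?mulr_ge0 // ltW.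
  - by rewrite divr_ge0 ?(ltW P0) ?sqrtr_ge0.
  - have : 1 <= M%:R / i%:R :> R by rewrite ler_pdivlMr // mul1r.
    have -> : 2 * L / (1 / 2) = 4 * L by field.
    by rewrite -mulrA; lra.
  - by rewrite ler_wpM2l ?(ltW P0) // lef_pV2 ?posrE // ler_wsqrtr // ler_nat.
set bound := 5 * _ * _ / _.
apply/not_existsP => none.
have : \sum_(T : {set 'I_K.+1}) bound < \sum_(T : {set 'I_K.+1}) #|small_samples (G T) M|%:R.
  apply: ltr_sum; first by apply/hasP; exists finset.set0; rewrite ?mem_index_enum.
  by move=> T _; rewrite ltNge; apply/negP/none.
apply/negP; rewrite -leNgt.
(* Double counting of the pairs (T, i) with |G| <= 1 at the i-th left end. *)
have -> : \sum_(T : {set 'I_K.+1}) #|small_samples (G T) M|%:R =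
    \sum_(i < M | (0 < i)%N) #|[set T | `|G T (i%:R * (pi / M%:R))| <= 1]%SET|%:R :> R.
  transitivity ((\sum_(T : {set 'I_K.+1}) \sum_(i < M | (0 < i)%N && (`|G T (i%:R * (pi / M%:R))| <= 1)%R) 1)%N%:R : R).
    by rewrite natr_sum; apply: eq_bigr => T _; rewrite -sum1_card; congr (_%:R); apply: eq_bigl => i; rewrite inE.
  rewrite (exchange_big_dep (fun i : 'I_M => (0 < i)%N)) /=; last by move=> T i _ /andP[].
  rewrite natr_sum; apply: eq_bigr => i i0; rewrite -sum1_card; congr (_%:R).
  by apply: eq_bigl => T; rewrite inE i0.
apply: le_trans (ler_sum _ rare) _.
have -> : \sum_(T : {set 'I_K.+1}) bound = P * bound.
  by rewrite sumr_const -cardsT -powersetT card_powerset cardsT -[LHS]mulr_natl natrX.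
have {rare} -> : \sum_(i < M | (0 < i)%N) 5 * M%:R / i%:R * (P / Num.sqrt m%:R) =
    (P * (5 * M%:R)) * (\sum_(i < M | (0 < i)%N) (i%:R)^-1 / Num.sqrt m%:R) :> R.
  by rewrite mulr_sumr; apply: eq_bigr => i _; ring.
rewrite -mulr_suml /bound -!mulrA ler_wpM2l ?(ltW P0) // !mulrA.
rewrite ler_wpM2r ?invr_ge0 ?(ltW mR) // ler_wpM2l //.
case: M M_gt1 {MR bound none} => [|[|M]] // _.
apply: le_trans (sum_inv_le_ln R M) _.
by rewrite lerD2l ler_ln ?posrE ?ltr0n // ler_nat.
Qed.

(** * Choice of the parameters *)

Lemma ln_ge_half (R : realType) (n : nat) : (2 <= n)%N -> 1 / 2 <= ln (n%:R : R).
Proof.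
move=> n2; have n0 : 0 < n%:R :> R by rewrite ltr0n; lia.
have n2R : 2 <= n%:R :> R by rewrite ler_nat.
have inv_le : (n%:R : R)^-1 <= 1 / 2 by rewrite mul1r lef_pV2 ?posrE.
have inv_gt : 0 < (n%:R : R)^-1 by rewrite invr_gt0.
have ltN1 : -1 < (n%:R : R)^-1 - 1 by lra.
have := le_ln1Dx ltN1; rewrite addrC subrK lnV ?posrE //; lra.
Qed.

Lemma scale_cube (R : realType) (y : R) : 0 <= y -> (y `^ (2 / 3)) ^+ 3 = y ^+ 2.
Proof.
move=> y0; rewrite -powR_mulrn ?powR_ge0 // -powRrM.
have -> : 2 / 3 * 3%:R = 2%:R :> R by field.
exact: powR_mulrn.
Qed.

Lemma sixth_root (R : realType) (x : R) : 0 < x -> exists2 t : R, 0 < t & t ^+ 6 = x.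
Proof.
move=> x0; exists (x `^ (1 / 6)); first exact: powR_gt0.
rewrite -powR_mulrn ?powR_ge0 // -powRrM.
have -> : 1 / 6 * 6%:R = 1 :> R by field.
by rewrite powRr1 // ltW.
Qed.

Lemma ln_le_id (R : realType) (t : R) : 0 < t -> ln t <= t.
Proof.
move=> t0; have ltN1 : -1 < t - 1 by lra.
have := le_ln1Dx ltN1; rewrite addrC subrK; lra.
Qed.

(** With t = n^(1/6) one has log n <= 6 t, so the fifteenth power of
    u = (n log n)^(2/3) is (n log n)^10 <= 6^10 t^70, whereas (n^4)^3 = t^72.
    The factor t^2 beats every constant. *)
Lemma scale_dominated (R : realType) (c : R) : 0 < c ->
  exists n0 : R, forall n : nat, (2 <= n)%N -> n0 < n%:R ->
    c * ((n%:R * ln n%:R) `^ (2 / 3)) ^+ 5 < n%:R ^+ 4.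
Proof.
(* Were the conclusion false, the cubes would give t^72 <= c^3 6^10 t^70. *)
move=> c0; exists ((c ^+ 3 * 6 ^+ 10) ^+ 3) => n n2 big_n.
have n0 : 0 < n%:R :> R by rewrite ltr0n; lia.
have [t t0 tn] := sixth_root n0.
rewrite ltNge; apply/negP => small.
set y := n%:R * ln n%:R in small; set u := y `^ (2 / 3) in small.
have ln0 : 0 <= ln (n%:R : R) by have := ln_ge_half R n2; lra.
have y0 : 0 <= y by rewrite mulr_ge0 // ltW.
have u0 : 0 <= u by apply: powR_ge0.
have ln_le : ln (n%:R : R) <= 6 * t.
  by rewrite -tn lnXn // -[leLHS]mulr_natl ler_wpM2l // ln_le_id.
have y_le : y <= 6 * t ^+ 7.
  rewrite /y -{1}tn; have -> : 6 * t ^+ 7 = t ^+ 6 * (6 * t) by ring.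
  by rewrite ler_wpM2l // exprn_ge0 // ltW.
have u15 : u ^+ 15 = y ^+ 10.
  by rewrite (exprM u 3 5) scale_cube // -exprM.
have : (n%:R ^+ 4) ^+ 3 <= (c * u ^+ 5) ^+ 3 :> R.
  by rewrite lerXn2r // nnegrE ?mulr_ge0 ?exprn_ge0 // ltW.
have -> : (n%:R ^+ 4) ^+ 3 = t ^+ 72 :> R by rewrite -tn -!exprM.
have -> : (c * u ^+ 5) ^+ 3 = c ^+ 3 * y ^+ 10 by rewrite exprMn -exprM -u15.
move=> pow_le.
have y10 : y ^+ 10 <= (6 * t ^+ 7) ^+ 10.
  by rewrite lerXn2r // nnegrE // mulr_ge0 // exprn_ge0 // ltW.
have : t ^+ 72 <= (c ^+ 3 * 6 ^+ 10) * t ^+ 70.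
  apply: le_trans pow_le _.
  have -> : c ^+ 3 * 6 ^+ 10 * t ^+ 70 = c ^+ 3 * (6 * t ^+ 7) ^+ 10.
    by ring.
  by rewrite ler_wpM2l // exprn_ge0 // ltW.
rewrite -[72%N]/(2 + 70)%N exprD ler_pM2r ?exprn_gt0 // => t2_le.
have : (t ^+ 2) ^+ 3 <= (c ^+ 3 * 6 ^+ 10) ^+ 3.
  by rewrite lerXn2r // nnegrE ?mulr_ge0 ?exprn_ge0 // ltW.
by rewrite -exprM tn leNgt big_n.
Qed.

(** The construction with K = 4m and M = 16n. The constant 11 * 5^5 * 2^4 comes
    from 2K + 3 <= 11 m, K + 1 <= 5 m and n <= 2 (N + 1/2). *)
Lemma few_zeros_large (R : realType) (n m : nat) :
    (2 <= n)%N -> (0 < m)%N ->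
    11 * 5 ^+ 5 * 2 ^+ 4 * m%:R ^+ 5 < (n%:R : R) ^+ 4 ->
  exists2 A : {fset nat}, #|` A| = n &
    exists2 b : nat, b%:R <= 5 * (16 * n)%:R * (1 + ln (16 * n)%:R) / Num.sqrt (m%:R : R) &
      card_at_most [set x : R | 0 <= x <= 2 * pi /\ cos_poly A x = 0]
        (2 * (5 * (1 + b + (4 * m).*2.+1) + 1)).
Proof.
move=> n2 m0 dom; have m1R : 1 <= m%:R :> R by rewrite ler1n.
have Kn : ((4 * m).+1 < n)%N.
  rewrite ltnNge; apply: contraTN dom => nK; rewrite -leNgt.
  have nKR : n%:R <= 5 * m%:R :> R by rewrite -natrM ler_nat; lia.
  apply: (@le_trans _ _ ((5 * m%:R) ^+ 4)); first by rewrite lerXn2r ?nnegrE ?mulr_ge0.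
  rewrite exprMn [m%:R ^+ 5]exprSr; have m4 : 0 <= m%:R ^+ 4 :> R by rewrite exprn_ge0.
  have : m%:R ^+ 4 * 1 <= m%:R ^+ 4 * m%:R :> R by rewrite ler_wpM2l.
  lra.
have [||T few] := @exists_few_small_samples R m (16 * n) _ _ => //; first by lia.
pose s := [seq val j | j <- enum T].
have uniq_s : uniq s by rewrite map_inj_uniq ?enum_uniq //; apply: val_inj.
have s_le : all (fun j => j <= 4 * m)%N s.
  by apply/allP => _ /mapP[j _ ->]; have := ltn_ord j.
have size_s : (size s <= (4 * m).+1)%N.
  by rewrite size_map -cardE; apply: leq_trans (max_card _) _; rewrite card_ord.
(* This value of N leaves exactly n frequencies after the removal. *)
pose N := (n + size s).-1.
have NE : (N.+1 = n + size s)%N by rewrite /N; lia.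
have KN : (4 * m <= N)%N by lia.
exists (gap_set N s).
  by have := card_gap_set KN uniq_s s_le; lia.
exists #|small_samples (@slow_part R s) (16 * n)|; first exact: few.
have nN : n%:R <= N%:R + 1 :> R by rewrite natr1 ler_nat; lia.
have Nn : N%:R + 1 <= 2 * n%:R :> R by rewrite natr1 -natrM ler_nat; lia.
have KR : (4 * m).+1%:R <= N%:R :> R by rewrite ler_nat; lia.
have n2R : 2 <= n%:R :> R by rewrite ler_nat.
apply: card_at_most_gap_set => //.
- by lia.
- set w := N%:R + 1 / 2.
  have w0 : 0 <= w by rewrite addr_ge0.
  have n_le : n%:R ^+ 4 <= 2 ^+ 4 * w ^+ 4.
    by rewrite -exprMn lerXn2r // ?nnegrE ?mulr_ge0 // /w; lra.
  have le1 : (4 * m).*2.+3%:R <= 11 * m%:R :> R by rewrite -natrM ler_nat; clear -m0; lia.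
  have le2 : (4 * m).+1%:R <= 5 * m%:R :> R by rewrite -natrM ler_nat; clear -m0; lia.
  have le3 : (4 * m).*2.+3%:R * (4 * m).+1%:R ^+ 4 <= 11 * m%:R * (5 * m%:R) ^+ 4 :> R.
    by apply: ler_pM => //; rewrite ?exprn_ge0 // lerXn2r ?nnegrE ?mulr_ge0.
  have e : 11 * 5 ^+ 5 * 2 ^+ 4 * m%:R ^+ 5 = 2 ^+ 4 * (5 * (11 * m%:R * (5 * m%:R) ^+ 4)) :> R.
    by ring.
  rewrite -(@ltr_pM2l _ (2 ^+ 4)) ?exprn_gt0 //; apply: lt_le_trans n_le.
  apply: le_lt_trans dom; rewrite e ler_wpM2l ?exprn_ge0 // ler_wpM2l //.
- lra.
- by rewrite natrM; lra.
Qed.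

Theorem theorem1p1 (R : realType) :
  exists2 C : R, 0 < C &
    forall n : nat, (2 <= n)%N ->
      exists2 A : {fset nat}, #|` A| = n &
        (Z (@cos_poly R A) <= (C * (n%:R * ln n%:R) `^ (2 / 3))%:E)%E.
Proof.
pose c : R := 11 * 5 ^+ 5 * 2 ^+ 4.
have c0 : 0 < c by rewrite !mulr_gt0 ?exprn_gt0.
have [|n0 dom] := @scale_dominated R (c * 2 ^+ 5).
  by rewrite mulr_gt0 ?exprn_gt0.
(* The term 2 |n0| covers the n up to n0, since (n log n)^(2/3) >= 1. *)
exists (30 * 10 ^+ 3 + 2 * `|n0|); first by rewrite ltr_wpDr ?mulr_ge0 ?mulr_gt0 ?exprn_gt0.
move=> n n2; have lnn := ln_ge_half R n2.
have nR : 2 <= n%:R :> R by rewrite ler_nat.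
set y := n%:R * ln n%:R; set u := y `^ (2 / 3).
have y1 : 1 <= y.
  have : 2 * (1 / 2) <= y by apply: ler_pM => //; lra.
  lra.
have u3 : u ^+ 3 = y ^+ 2 by apply: scale_cube; lra.
have u1 : 1 <= u.
  have u0 : 0 <= u by apply: powR_ge0.
  by rewrite -(@expr_ge1 _ 3) // u3 expr_ge1 //; lra.
have finish A d : card_at_most [set x : R | 0 <= x <= 2 * pi /\ cos_poly A x = 0] d ->
    d%:R <= (30 * 10 ^+ 3 + 2 * `|n0|) * u ->
    (Z (@cos_poly R A) <= ((30 * 10 ^+ 3 + 2 * `|n0|) * u)%:E)%E.
  by move=> /counting_le card_d d_le; apply: le_trans (card_d R) _; rewrite lee_fin.
case: (lerP n%:R n0) => [small | big].
  have card_A : #|` gap_set n.-1 [::]| = n.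
    have := @card_gap_set n.-1 0 [::] (leq0n _) isT isT; rewrite addn0 => ->; lia.
  exists (gap_set n.-1 [::]) => //; apply: (finish _ (2 * n.-1)%N).
    apply: card_at_most_cos_poly; first by rewrite card_A; lia.
    move=> j; rewrite (perm_mem (perm_gap_set _ _)) mem_filter mem_iota add0n ltnS.
    by move=> /andP[_ /andP[_]].
  have : (2 * n.-1)%:R <= 2 * n%:R :> R by rewrite -natrM ler_nat; lia.
  have : `|n0| * 1 <= `|n0| * u by rewrite ler_wpM2l.
  have := ler_norm n0; lra.
pose m := (Num.truncn u).+1.
have um : u <= m%:R by rewrite ltW // truncnS_gt.
have mu : m%:R <= 2 * u.
  have : (Num.truncn u)%:R <= u by rewrite truncn_le; lra.
  by rewrite /m -natr1; lra.
have dom_m : c * m%:R ^+ 5 < n%:R ^+ 4.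
  apply: le_lt_trans (dom _ n2 big); rewrite -/y -/u -mulrA ler_wpM2l ?(ltW c0) //.
  by rewrite -exprMn lerXn2r // nnegrE; lra.
have [A card_A [b b_le card_zeros]] := few_zeros_large n2 (ltn0Sn _) dom_m.
exists A => //; apply: finish card_zeros _.
have mR : 0 < m%:R :> R by rewrite ltr0n.
have sm : 0 < Num.sqrt (m%:R : R) by rewrite sqrtr_gt0.
(* This is where m is matched to n: u^3 = y^2 and u <= m give y^2 <= u^2 m. *)
have y_le : y / Num.sqrt m%:R <= u.
  rewrite ler_pdivrMr // -(@ler_pXn2r _ 2) ?nnegrE ?mulr_ge0 ?(ltW sm) //; try lra.
  by rewrite [(u * _) ^+ 2]exprMn sqr_sqrtr // -u3 exprSr ler_wpM2l ?exprn_ge0 //; lra.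
(* 1 + ln (16 n) <= 33 ln n because ln 16 <= 15 and ln n >= 1/2. *)
have b_u : b%:R <= 80 * 33 * u.
  apply: le_trans b_le _.
  have ln16 : ln (16 : R) <= 15.
    have /le_ln1Dx : -1 < 15 :> R by lra.
    have -> : 1 + 15 = 16 :> R by ring.
    by [].
  rewrite natrM lnM ?posrE //; try lra.
  apply: (@le_trans _ _ (80 * 33 * (y / Num.sqrt m%:R))); last by rewrite ler_wpM2l.
  rewrite [leRHS]mulrA ler_wpM2r ?invr_ge0 ?(ltW sm) //.
  have -> : 80 * 33 * y = 5 * (16 * n%:R) * (33 * ln n%:R) by rewrite /y; ring.
  by rewrite ler_wpM2l ?mulr_ge0 //; lra.
have : 0 <= `|n0| * u by rewrite mulr_ge0 //; lra.
rewrite natrM natrD natrM !natrD.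
have -> : (4 * m).*2.+1%:R = 8 * m%:R + 1 :> R.
  by rewrite -natrM natr1; congr (_%:R); move: (m) => k; clear; lia.
lra.
Qed.
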